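(* Let $\mathcal{H}$ be a complex Hilbert space and let $T$ be a bounded linear operator on $\mathcal{H}$. Then for every positive integer $n\geq 2$, $$w^n(T) \leq \frac{1}{2^{n-1}} w(T^n) + \sum_{k=1}^{n-1} \frac{1}{2^{k}} \left\|T^k\right\| \left\|T\right\|^{n-k}.$$
   Context: For a bounded linear operator $A$ on $\mathcal{H}$, $\|A\|$ denotes the usual operator norm and $w(A)=\sup\{|\langle Ax,x\rangle| : x\in\mathcal{H},\ \|x\|=1\}$ denotes the numerical radius; $w^n(A)$ means $(w(A))^n$. *)

(* Defs.v *)
From mathcomp Require Import all_boot all_order all_algebra.
From mathcomp Require Import sesquilinear complex.
From mathcomp Require Import all_classical all_reals all_analysis.

Set Implicit Arguments.
Unset Strict Implicit.
Unset Printing Implicit Defensive.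

Import Order.TTheory GRing.Theory Num.Theory Num.Def.
Import numFieldNormedType.Exports.

Local Open Scope classical_set_scope.
Local Open Scope ring_scope.

(* A complex Hilbert space is a complete normed module H over R[i] with a
   positive definite Hermitian form dot inducing the norm.  Such a form is linear
   in its first argument and conjugate-linear in its second one.
   Norms (of vectors and of scalars) take values in R[i], where they are real
   and nonnegative; complex.Re brings them back to R. *)

Definition bounded_operator (R : realType) (H : normedModType R[i])
    (A : H -> H) : Prop :=
  exists M : R, forall x : H, `|A x| <= M%:C%C * `|x|.

Definition opnorm (R : realType) (H : normedModType R[i]) (A : H -> H) : R :=
  sup [set complex.Re `|A x| | x in [set x : H | `|x| <= 1]].

(* On the zero space there is no unit vector, and the value is sup set0 = 0. *)
Definition numerical_radius (R : realType) (H : normedModType R[i])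
    (dot : {dot H for conjC}) (A : H -> H) : R :=
  sup [set complex.Re `|dot (A x) x| | x in [set x : H | `|x| = 1]].

(* Main.v *)
Require Import Defs.
From mathcomp Require Import all_boot all_order all_algebra.
From mathcomp Require Import sesquilinear complex.
From mathcomp Require Import all_classical all_reals all_analysis.
From mathcomp Require Import ring.

(** Fix a unit vector x and put c_k = |<T^k x, x>|.  Buzano's inequality,
    applied to T^k x and the adjoint image of x, reads
      2 c_1 c_k <= c_(k+1) + ||T|| ||T^k x||,
    and lets one trade a factor c_1 for a halving: starting from c_1^n and using
    it n - 1 times, with c_1 <= ||T|| for the factors left over, gives
      c_1^n <= c_n / 2^(n-1) + \sum_(1 <= k < n) ||T^k|| ||T||^(n-k) / 2^k
    ([buzano_iteration]).  Since c_n <= w(T^n), taking the supremum over x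
    concludes ([exprn_sup_le]).

    The inequality itself is obtained without an adjoint ([buzano_operator]):
    the map u |-> 2<u, x>x - u is the reflection in the line spanned by x, hence
    an isometry ([norm_reflection]), and applying T to the decomposition of
    2<u, x>x as u plus the reflected vector gives
      2 <u, x><Tx, x> = <Tu, x> + <T(2<u, x>x - u), x>,
    whose last term is at most ||T|| ||u|| in absolute value. *)

Import Order.TTheory GRing.Theory Num.Theory Num.Def.
Import numFieldNormedType.Exports.

Local Open Scope classical_set_scope.
Local Open Scope ring_scope.

Lemma Re_normK {R : realType} {V : normedZmodType R[i]} (v : V) :
  (complex.Re `|v|)%:C%C = `|v|.
Proof. by rewrite RRe_real // normr_real. Qed.

Lemma Re_norm_ge0 {R : realType} {V : normedZmodType R[i]} (v : V) :
  0 <= complex.Re `|v|.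
Proof. by rewrite -ler0c Re_normK. Qed.

(** When S is empty or unbounded, [sup S] is 0 by convention. *)
Lemma sup_ge0 {R : realType} {S : set R} :
  (forall s, S s -> 0 <= s) -> 0 <= sup S.
Proof.
move=> S0; have [supS|/sup_out-> //] := pselect (has_sup S).
have [s Ss] := supS.1; apply: le_trans (S0 _ Ss) _.
by apply: ub_le_sup Ss; case: supS.
Qed.

(** Reflecting u in the line of x keeps the component along x and negates the
    orthogonal one, so Pythagoras gives the same norm; the proof expands the
    square. *)
Lemma norm_reflection {R : realType} {H : normedModType R[i]}
    {dot : {dot H for conjC}} (dot_norm : forall x : H, `|x| ^+ 2 = dot x x)
    {x : H} (u : H) :
  `|x| = 1 -> `|(2 * dot u x) *: x - u| = `|u|.
Proof.
move=> x1; have xx : dot x x = 1 by rewrite -dot_norm x1 expr1n.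
apply/eqP; rewrite -(@eqrXn2 _ 2) //; apply/eqP; rewrite !dot_norm.
have xu : dot x u = (dot u x)^* by rewrite hermC expr0 mul1r.
have dotZl a v w : dot (a *: v) w = a * dot v w by rewrite linearZl_LR.
have dotZr a v w : dot v (a *: w) = a^* * dot v w by rewrite linearZr_LR.
rewrite linearBl !linearBr /= !dotZl !dotZr xx xu.
rewrite [(2 * _)^*]rmorphM rmorph_nat /=; ring.
Qed.

(** The case of the Cauchy-Schwarz inequality where one vector is a unit vector:
    2<u, x>x is the sum of u and its reflection, two vectors of norm ||u||. *)
Lemma normr_dot_le {R : realType} {H : normedModType R[i]}
    {dot : {dot H for conjC}} (dot_norm : forall x : H, `|x| ^+ 2 = dot x x)
    {x : H} (u : H) :
  `|x| = 1 -> `|dot u x| <= `|u|.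
Proof.
move=> x1; rewrite -(ler_pM2l (ltr0Sn _ 1)).
have := ler_normD ((2 * dot u x) *: x - u) u.
rewrite subrK norm_reflection // normrZ x1 mulr1 normrM normr_nat.
by rewrite [2 * `|u|]mulr_natl mulr2n.
Qed.

Lemma bounded_operator_iter {R : realType} {H : normedModType R[i]}
    {A : H -> H} (k : nat) :
  bounded_operator A -> bounded_operator (iter k A).
Proof.
(* On the zero space M may be negative, hence the absolute value. *)
move=> [M AM]; exists (`|M| ^+ k) => x.
elim: k => [|k IHk] /=; first by rewrite expr0 mul1r.
apply: le_trans (AM _) _; rewrite exprS rmorphM /= -mulrA.
apply: le_trans (ler_wpM2l _ IHk); last by rewrite ler0c.
by apply: ler_wpM2r; rewrite ?normr_ge0 // lecR ler_norm.
Qed.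

Lemma le_opnorm {R : realType} {H : normedModType R[i]} {A : H -> H} {x : H} :
  bounded_operator A -> `|x| <= 1 -> complex.Re `|A x| <= opnorm A.
Proof.
move=> [M AM] x1; apply: ub_le_sup; last by exists x.
exists `|M| => _ [y /= y1 <-]; rewrite -lecR Re_normK.
apply: le_trans (AM y) _.
apply: le_trans (ler_wpM2r (normr_ge0 _) _) (ler_piMr _ y1).
  by rewrite lecR ler_norm.
by rewrite ler0c.
Qed.

Lemma opnorm_ge0 {R : realType} {H : normedModType R[i]} {A : H -> H} :
  bounded_operator A -> 0 <= opnorm A.
Proof.
move=> Ab; apply: le_trans (Re_norm_ge0 (A 0)) (le_opnorm Ab _).
by rewrite normr0 ler01.
Qed.

Lemma opnormP {R : realType} {H : normedModType R[i]} {A : {linear H -> H}}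
    (x : H) :
  bounded_operator A -> `|A x| <= (opnorm A)%:C%C * `|x|.
Proof.
move=> Ab; have [->|x0] := eqVneq x 0; first by rewrite linear0 !normr0 mulr0.
have nx0 : 0 < `|x| by rewrite normr_gt0.
have /(@le_opnorm _ _ _ _ Ab) : `|(`|x|^-1 *: x)| <= 1.
  by rewrite normrZ normfV normr_id mulVf // gt_eqF.
rewrite -lecR Re_normK linearZ /= normrZ normfV normr_id mulrC.
by rewrite ler_pdivrMr.
Qed.

Lemma le_numerical_radius {R : realType} {H : normedModType R[i]}
    {dot : {dot H for conjC}} (dot_norm : forall x : H, `|x| ^+ 2 = dot x x)
    {A : H -> H} {x : H} :
  bounded_operator A -> `|x| = 1 ->
  complex.Re `|dot (A x) x| <= numerical_radius dot A.
Proof.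
move=> Ab x1; apply: ub_le_sup; last by exists x.
exists (opnorm A) => _ [y /= y1 <-].
apply: le_trans (@le_opnorm _ _ _ y Ab _); last by rewrite y1.
by rewrite -lecR !Re_normK normr_dot_le.
Qed.

Lemma numerical_radius_ge0 {R : realType} {H : normedModType R[i]}
    {dot : {dot H for conjC}} {A : H -> H} :
  0 <= numerical_radius dot A.
Proof. by apply: sup_ge0 => _ [x _ <-]; exact: Re_norm_ge0. Qed.

(** Buzano's inequality for the vectors u and T* x, where the reflection in the
    line of x replaces the adjoint T*. *)
Lemma buzano_operator {R : realType} {H : normedModType R[i]}
    {dot : {dot H for conjC}} (dot_norm : forall x : H, `|x| ^+ 2 = dot x x)
    {T : {linear H -> H}} {x : H} (u : H) :
  bounded_operator T -> `|x| = 1 ->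
  2 * complex.Re `|dot (T x) x| * complex.Re `|dot u x| <=
  complex.Re `|dot (T u) x| + opnorm T * complex.Re `|u|.
Proof.
move=> Tb x1.
(* Norms live in R[i]: the inequality is proved there and read back in R. *)
have complexify (t c d p B : R) :
    2 * t%:C%C * c%:C%C <= d%:C%C + B%:C%C * p%:C%C -> 2 * t * c <= d + B * p.
  by rewrite -lecR rmorphD !rmorphM rmorph_nat.
apply: complexify; rewrite !Re_normK.
have reflE : 2 * dot u x * dot (T x) x =
    dot (T u) x + dot (T ((2 * dot u x) *: x - u)) x.
  rewrite linearB linearZ linearBl /= [dot (_ *: _) _]linearZl_LR.
  by rewrite addrC subrK.
rewrite -[2](@normr_nat R[i]) -!normrM mulrAC reflE.
apply: le_trans (ler_normD _ _) _; rewrite lerD2l.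
apply: le_trans (normr_dot_le dot_norm _ x1) _.
by rewrite -(norm_reflection dot_norm u x1) opnormP.
Qed.

(** The scalar recursion behind the theorem, with c k = |<T^k x, x>|,
    N k = ||T^k|| and B = ||T||.  Multiplying the bound for n by c 1, the term
    with c n splits by the step inequality into the new leading term and the
    summand of index n, while in the other summands c 1 is bounded by B. *)
Lemma buzano_iteration {R : realFieldType} {c N : nat -> R} {B : R} :
  0 <= c 1%N <= B -> (forall k, 0 <= N k) ->
  (forall k, 2 * c 1%N * c k <= c k.+1 + B * N k) ->
  forall n, (0 < n)%N ->
  c 1%N ^+ n <= 1 / 2 ^+ (n - 1) * c n +
    \sum_(1 <= k < n) 1 / 2 ^+ k * N k * B ^+ (n - k).
Proof.
move=> /andP[t0 tB] N0 step [//|n] _; rewrite subn1 /=.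
elim: n => [|n IHn]; first by rewrite big_geq // expr0 divr1 mul1r addr0 expr1.
rewrite exprS; apply: le_trans (ler_wpM2l t0 IHn) _.
rewrite mulrDr [X in _ <= _ + X]big_nat_recr //= subSnn expr1.
rewrite [leRHS]addrCA [leRHS]addrC.
apply: lerD.
  have -> : c 1%N * (1 / 2 ^+ n * c n.+1) =
      1 / 2 ^+ n.+1 * (2 * c 1%N * c n.+1).
    by rewrite exprS; field; rewrite expf_neq0 ?pnatr_eq0.
  rewrite -(mulrA _ _ B) (mulrC _ B) -mulrDr; apply: ler_wpM2l (step _).
  by rewrite divr_ge0 // exprn_ge0.
rewrite mulr_sumr; apply: ler_sum_nat => k /andP[_ kn].
rewrite mulrCA [(n.+2 - k)%N]subSn 1?ltnW // exprS.
apply: ler_wpM2l; first by rewrite mulr_ge0 // divr_ge0 // exprn_ge0.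
by rewrite ler_wpM2r // exprn_ge0 // (le_trans t0).
Qed.

(** The bound passes to the supremum because x |-> x ^+ n is increasing on
    nonnegative reals: each element of S is at most the n-th root of b. *)
Lemma exprn_sup_le {R : realType} {S : set R} {b : R} {n : nat} :
  (0 < n)%N -> 0 <= b -> (forall s, S s -> 0 <= s /\ s ^+ n <= b) ->
  sup S ^+ n <= b.
Proof.
move=> n0 b0 Sb; have n0R : n%:R != 0 :> R by rewrite pnatr_eq0 -lt0n.
have [->|/set0P S0] := eqVneq S set0; first by rewrite sup0 expr0n eqn0Ngt n0.
have rootn : (b `^ n%:R^-1) ^+ n = b.
  by rewrite -powR_mulrn ?powR_ge0 // -powRrM mulVf // powRr1.
rewrite -[leRHS]rootn lerXn2r ?nnegrE ?powR_ge0 //.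
  by apply: sup_ge0 => s /Sb[].
apply: ge_sup => // s /Sb[s0 sb].
by rewrite -(@ler_pXn2r _ n) ?nnegrE ?powR_ge0 // rootn.
Qed.

Theorem corollary3p2 (R : realType) (H : completeNormedModType R[i])
    (dot : {dot H for conjC}) (dot_norm : forall x : H, `|x| ^+ 2 = dot x x)
    (T : {linear H -> H}) (T_bounded : bounded_operator T)
    (n : nat) (n_ge2 : (2 <= n)%N) :
  numerical_radius dot T ^+ n <=
    1 / 2 ^+ (n - 1) * numerical_radius dot (iter n T) +
    \sum_(1 <= k < n)
      1 / 2 ^+ k * opnorm (iter k T) * opnorm T ^+ (n - k).
Proof.
have n0 : (0 < n)%N by exact: ltnW.
have Tkb k : bounded_operator (iter k T) by exact: bounded_operator_iter.
apply: exprn_sup_le => //.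
  rewrite addr_ge0 ?mulr_ge0 ?divr_ge0 ?exprn_ge0 ?numerical_radius_ge0 //.
  apply: sumr_ge0 => k _.
  by rewrite !mulr_ge0 ?divr_ge0 ?exprn_ge0 ?opnorm_ge0.
move=> _ [x x1 <-]; have {}x1 : `|x| = 1 by [].
split; first exact: Re_norm_ge0.
pose c k : R := complex.Re `|dot (iter k T x) x|.
have cn : c n <= numerical_radius dot (iter n T) by exact: le_numerical_radius.
have /le_trans : c 1%N ^+ n <= 1 / 2 ^+ (n - 1) * c n +
    \sum_(1 <= k < n) 1 / 2 ^+ k * opnorm (iter k T) * opnorm T ^+ (n - k).
  apply: buzano_iteration => // [|k|k].
  - rewrite Re_norm_ge0 /=.
    apply: le_trans (le_opnorm T_bounded (_ : `|x| <= 1)); last by rewrite x1.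
    by rewrite -lecR !Re_normK normr_dot_le.
  - exact: opnorm_ge0.
  - apply: le_trans (buzano_operator dot_norm (iter k T x) T_bounded x1) _.
    rewrite lerD2l ler_wpM2l ?opnorm_ge0 //.
    by rewrite le_opnorm // x1.
by apply; rewrite lerD2r ler_wpM2l // divr_ge0 // exprn_ge0.
Qed.
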